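(* Let $X$ be a continuum. Then $B(x)\subset \pi(x)$ for all $x\in X$.
   Context: A continuum is a nonempty compact connected metric space. $2^X$ is the space of all nonempty closed subsets of $X$ with the Hausdorff metric, and $\mathcal C(X)\subset 2^X$ is the subspace of connected ones. An order arc is a continuous map $\alpha:[0,1]\to 2^X$ such that $\alpha(s)\subsetneq\alpha(t)$ whenever $0\le s<t\le 1$. For $A, B \in 2^X$, $B$ does not block $A$ if there is a continuous map $\gamma:[0,1]\to 2^X$ with $\gamma(0)=A$, $\gamma(1)=X$ and $\gamma(t)\cap B=\emptyset$ for all $t<1$; otherwise $B$ blocks $A$. For $a \in X$, $B(a)=\{y\in X : \{a\}\text{ blocks }\{y\}\}$. A nonblocker of $X$ is a set $A\in 2^X\setminus\{X\}$ such that for every $x\in X\setminus A$ there is an order arc $\alpha:[0,1]\to \mathcal C(X)$ with $\alpha(0)=\{x\}$, $\alpha(1)=X$ and $\alpha(t)\cap A=\emptyset$ for all $t\in[0,1)$. For $a\in X$, $\pi(a)$ is the intersection of all nonblockers of $X$ containing $a$ if at least one exists, and $\pi(a)=X$ otherwise. *)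

(* Defs.v *)
From HB Require Import structures.
From mathcomp Require Import all_boot all_order all_algebra.
From mathcomp Require Import all_classical all_reals all_analysis.

Set Implicit Arguments.
Unset Strict Implicit.
Unset Printing Implicit Defensive.

Import Order.TTheory GRing.Theory Num.Theory.
Import numFieldNormedType.Exports.

Local Open Scope classical_set_scope.
Local Open Scope ring_scope.

HB.mixin Record isContinuum (R : realType) X & Metric R X := {
  continuum_nonempty : [set: X] !=set0 ;
  continuum_compact : compact [set: X] ;
  continuum_connected : connected [set: X]
}.

#[short(type="continuumType")]
HB.structure Definition Continuum (R : realType) :=
  { X of Metric R X & isContinuum R X }.

(* The hyperspace 2^X; its metric is installed below. *)
Record hyperspace (R : realType) (X : continuumType R) := Hyperspace {
  hset :> set X ;
  hset_closed : closed hset ;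
  hset_nonempty : hset !=set0
}.

Section hausdorff_metric.
Context {R : realType} {X : continuumType R}.
Implicit Types A B C : hyperspace X.

Lemma hset_inj A B : A = B :> set X -> A = B.
Proof.
case: A B => [A cA nA] [B cB nB] /= AB.
by case: _ / AB cB nB => cB nB; congr Hyperspace; exact: Prop_irrelevance.
Qed.

HB.instance Definition _ := gen_eqMixin (hyperspace X).
HB.instance Definition _ := gen_choiceMixin (hyperspace X).

Definition thickening (r : R) (A : set X) : set X := \bigcup_(a in A) ball a r.

Definition hausdorff_radii (A B : set X) : set R :=
  [set r | [/\ 0 < r, A `<=` thickening r B & B `<=` thickening r A]].

Definition hausdorff_dist A B : R := inf (hausdorff_radii A B).

Lemma continuum_bounded : exists M : R, forall x y : X, ball x M y.
Proof.
have [x0 _] := @continuum_nonempty R X.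
have /compact_near_coveringP/(_ _ \oo (fun (n : nat) x => ball x0 n%:R x)) :=
  @continuum_compact R X.
case.
- move=> x _; near=> z n => /=.
  have xz : ball x 1 z by near: z; exact: nbhsx_ballx.
  have x0x : ball x0 (mdist x0 x + 1) x by rewrite ballEmdist/= ltrDl.
  apply: le_ball (ball_triangle x0x xz).
  by near: n; exact: nbhs_infty_ger.
- move=> N _ /(_ N (leqnn N)) bN.
  exists (N%:R + N%:R) => x y.
  by apply: ball_triangle (bN y I); exact/ball_sym/bN.
Unshelve. all: by end_near. Qed.

Lemma hausdorff_radii_has_inf A B : has_inf (hausdorff_radii A B).
Proof.
split; last by exists 0 => r [/ltW].
have [M bM] := continuum_bounded.
have [[a Aa] [b Bb]] := (hset_nonempty A, hset_nonempty B).
exists M; split=> [|x _|x _]; [|by exists b|by exists a].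
by have := bM a a; rewrite ballEmdist/= mdistxx.
Qed.

Lemma hausdorff_dist_xx A : hausdorff_dist A A = 0.
Proof.
have hA := hausdorff_radii_has_inf A A.
apply/eqP; rewrite eq_le; apply/andP; split.
  apply/ler_addgt0Pr => e e0; rewrite add0r; apply: ge_inf; first exact: hA.2.
  by split=> // x Ax; exists x => //; exact: ballxx.
by apply: lb_le_inf => [|r [/ltW]]; first exact: hA.1.
Qed.

Lemma hausdorff_dist_sym A B : hausdorff_dist A B = hausdorff_dist B A.
Proof. by congr inf; apply/seteqP; split=> r []. Qed.

Lemma hausdorff_dist_eq0 A B : hausdorff_dist A B = 0 -> A = B.
Proof.
wlog suff AB : A B / hausdorff_dist A B = 0 -> A `<=` B.
  move=> AB0; apply/hset_inj/seteqP; split; apply: AB => //.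
  by rewrite hausdorff_dist_sym.
move=> AB0 x Ax; apply: (@hset_closed _ _ B x) => V /nbhs_ballP[e /= e0 eV].
have := inf_adherent e0 (hausdorff_radii_has_inf A B).
rewrite -/(hausdorff_dist A B) AB0 add0r => -[r [r0 /(_ _ Ax)[y By yx] _] re].
exists y; split=> //; apply: eV; apply/ball_sym.
exact: le_ball (ltW re) _ yx.
Qed.

Lemma hausdorff_dist_triangle B A C :
  hausdorff_dist A C <= hausdorff_dist A B + hausdorff_dist B C.
Proof.
have [hAB hBC] := (hausdorff_radii_has_inf A B, hausdorff_radii_has_inf B C).
rewrite -lerBlDr; apply: lb_le_inf; first exact: hAB.1.
move=> r [r0 rAB rBA].
rewrite lerBlDr -lerBlDl; apply: lb_le_inf; first exact: hBC.1.
move=> s [s0 sBC sCB]; rewrite lerBlDl; apply: ge_inf.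
  exact: (hausdorff_radii_has_inf A C).2.
split; first exact: addr_gt0.
- move=> x /rAB[y /sBC[z Cz zy] yx]; exists z => //.
  by rewrite addrC; exact: ball_triangle zy yx.
- move=> z /sCB[y /rBA[x Ax xy] yz]; exists x => //.
  exact: ball_triangle xy yz.
Qed.

HB.instance Definition _ := @isMetric.Build R (hyperspace X) hausdorff_dist
  hausdorff_dist_xx hausdorff_dist_eq0 hausdorff_dist_sym
  hausdorff_dist_triangle.

Definition hwhole : hyperspace X :=
  Hyperspace (@closedT X) (@continuum_nonempty R X).

Lemma closed_point (x : X) : closed [set x].
Proof.
exact: accessible_closed_set1 (hausdorff_accessible (@metric_hausdorff R X)) x.
Qed.

Definition hpoint (x : X) : hyperspace X :=
  Hyperspace (@closed_point x) (ex_intro _ x erefl).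

(* The subspace C(X) of 2^X. *)
Definition subcontinua : set (hyperspace X) := [set A | connected A].

(* Maps on [0,1] are total functions on R, looked at on [0,1] only. *)
Definition order_arc (alpha : R -> hyperspace X) : Prop :=
  {within `[0, 1], continuous alpha} /\
  (forall s t, 0 <= s -> s < t -> t <= 1 -> alpha s `<` alpha t).

Definition does_not_block (B A : hyperspace X) : Prop :=
  exists gamma : R -> hyperspace X,
    [/\ {within `[0, 1], continuous gamma},
        gamma 0 = A, gamma 1 = hwhole &
        forall t, 0 <= t -> t < 1 -> gamma t `&` B = set0].

Definition blocks (B A : hyperspace X) : Prop := ~ does_not_block B A.

(* B(a) *)
Definition blocked_by (a : X) : set X := [set y | blocks (hpoint a) (hpoint y)].

Definition nonblocker (A : hyperspace X) : Prop :=
  A <> hwhole /\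
  forall x : X, ~ hset A x ->
    exists alpha : R -> hyperspace X,
      [/\ order_arc alpha,
          forall t, 0 <= t -> t <= 1 -> subcontinua (alpha t),
          alpha 0 = hpoint x, alpha 1 = hwhole &
          forall t, 0 <= t -> t < 1 -> alpha t `&` A = set0].

(* pi(a) *)
Definition nonblocker_hull (a : X) : set X :=
  if `[< exists A, nonblocker A /\ hset A a >]
  then \bigcap_(A in [set A | nonblocker A /\ hset A a]) hset A
  else [set: X].

End hausdorff_metric.

(* Main.v *)
Require Import Defs.
From HB Require Import structures.
From mathcomp Require Import all_boot all_order all_algebra.
From mathcomp Require Import all_classical all_reals all_analysis.

Local Open Scope classical_set_scope.

(** Every nonblocker [A] containing [x] absorbs the points blocked by [{x}]. If [y] lay outside [A],
    the order arc growing from [{y}] to [X] and missing [A] before time 1 would also miss [x], so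
    [{x}] would not block [{y}]. When no such [A] exists, the hull is all of [X]. *)

Theorem mainTheorem2 (R : realType) (X : continuumType R) (x : X) :
  blocked_by x `<=` nonblocker_hull x.
Proof.
move=> y xy; rewrite /nonblocker_hull; case: asboolP => // _ A [[_ nbA] Ax].
apply: contrapT => /nbA[alpha [[calpha _] _ alpha0 alpha1 alphaA]].
apply: xy; exists alpha; split=> // t t0 t1.
(* Missing [A] is inherited by [{x}], a subset of [A]. *)
apply: subsetI_eq0 (alphaA _ t0 t1) => //.
by move=> _ ->.
Qed.
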